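(* Let $\mathcal{F}$ be a periodic infinite frieze of positive integers with growth coefficients $(s_k)_{k\ge0}$. The following are equivalent: (a) There exists $k>0$ such that $s_k=2$. (b) $s_k=2$ for all $k\ge0$. (c) $\mathcal{F}$ arises from a triangulation of a punctured disc.
   Context: An infinite frieze of positive integers is an array $(m_{i,j})$, indexed by $i\in\mathbb{Z}$ and $j\ge i-2$, with $m_{i,i-2}=0$, $m_{i,i-1}=1$, with $m_{i,j}$ a positive integer for $j\ge i-1$, and with $m_{i,j}m_{i+1,j+1}-m_{i,j+1}m_{i+1,j}=1$ for all $i$ and all $j\ge i-1$. It is periodic if for some $n\ge1$ one has $m_{i+n,j+n}=m_{i,j}$ for all entries. With $n$ the minimal such period, the growth coefficients are $s_0:=2$ and $s_k:=m_{1,kn}-m_{2,kn-1}$ for $k\ge1$. The quiddity row is $a_i=m_{i,i}$; a finite block of consecutive entries whose periodic repetition is the quiddity row is called a quiddity sequence of the frieze (its length is a period, not necessarily minimal). A triangulation of a punctured disc is a maximal collection of pairwise non-crossing (non-self-crossing) arcs, up to isotopy, in the once-punctured disc with $N\ge1$ marked points on its boundary, with endpoints in the set consisting of the marked points and the puncture, none of which is contractible or isotopic to a boundary segment (loops based at boundary marked points around the puncture are allowed). It gives the sequence $(a_1,\dots,a_N)$, where $a_i$ is the number of regions incident with the boundary marked point $i$, counted in a small neighbourhood of it (i.e. one plus the number of ends of arcs at $i$), marked points being taken in cyclic order. A periodic infinite frieze of positive integers arises from a triangulation of a punctured disc if it has a quiddity sequence obtained in this way. It is known (Baur–Parsons–Tschabold)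 that every such triangulation yields a periodic infinite frieze of positive integers, that triangulations of annuli do so likewise (for each boundary component), and that every periodic infinite frieze of positive integers arises from a triangulation of a punctured disc or of an annulus. *)

(* Defs.v *)
From HB Require Import structures.
From mathcomp Require Import all_boot all_order all_algebra.

Set Implicit Arguments.
Unset Strict Implicit.
Unset Printing Implicit Defensive.

Import Order.TTheory GRing.Theory Num.Theory.
Local Open Scope ring_scope.

(* An array is a total function [m : int -> int -> int], of which only the
   entries [m i j] with [i - 2 <= j] are meaningful; nothing below constrains
   or uses the other values. *)

Definition infinite_frieze (m : int -> int -> int) : Prop :=
  [/\ forall i : int, m i (i - 2) = 0,
      forall i : int, m i (i - 1) = 1,
      forall i j : int, i - 1 <= j -> 0 < m i j
    & forall i j : int, i - 1 <= j ->
        m i j * m (i + 1) (j + 1) - m i (j + 1) * m (i + 1) j = 1].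

Definition is_period (m : int -> int -> int) (n : nat) : Prop :=
  (0 < n)%N /\
  forall i j : int, i - 2 <= j -> m (i + n%:Z) (j + n%:Z) = m i j.

Definition minimal_period (m : int -> int -> int) (n : nat) : Prop :=
  is_period m n /\ forall n' : nat, is_period m n' -> (n <= n')%N.

Definition growth_coefficient (m : int -> int -> int) (n k : nat) : int :=
  if k == 0%N then 2 else m 1 (k * n)%N%:Z - m 2 ((k * n)%N%:Z - 1).

(* [s] may start anywhere in the quiddity row [i |-> m i i], and its length
   need not be the minimal period. *)
Definition quiddity_sequence (m : int -> int -> int) (s : seq nat) : Prop :=
  (0 < size s)%N /\
  exists i0 : int, forall j : int,
    m (i0 + j) (i0 + j) = (nth 0%N s `|(j %% (size s)%:Z)%Z|%N)%:Z.

(* Arcs in the disc with one puncture and N >= 1 marked boundary points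
   0, ..., N - 1 in cyclic order.  The universal cover of the punctured disc is
   a half-plane with boundary line R; the puncture goes to infinity, the
   integers congruent to i modulo N are the lifts of the marked point i, and
   the deck transformations are the translations by multiples of N.
   - [Bridging i] is the isotopy class of arcs joining i to the puncture
     (unique up to isotopy, as winding around the puncture can be undone);
     its lifts are the vertical half-lines above the integers i + t N.
   - [Peripheral i l], for l > 0, is the homotopy class of the curves that have
     a lift joining the boundary points i and i + l; its lifts join i + t N to
     i + l + t N.  Every non-contractible unoriented curve between marked
     points lies in exactly one of these classes.  The curve is a loop when N
     divides l, and surrounds the puncture once when l = N.
   A non-self-crossing loop based at the puncture is contractible, so there are
   no other arcs. *)
Inductive curve (N : nat) : Type :=
  | Bridging of 'I_N
  | Peripheral of 'I_N & nat.
Arguments Bridging {N}.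
Arguments Peripheral {N}.

Definition curve_code (N : nat) (c : curve N) : 'I_N + 'I_N * nat :=
  match c with Bridging i => inl i | Peripheral i l => inr (i, l) end.
Definition curve_decode (N : nat) (u : 'I_N + 'I_N * nat) : curve N :=
  match u with inl i => Bridging i | inr (i, l) => Peripheral i l end.
Lemma curve_codeK (N : nat) : cancel (@curve_code N) (@curve_decode N).
Proof. by case. Qed.
HB.instance Definition _ (N : nat) :=
  Equality.copy (curve N) (can_type (@curve_codeK N)).

(* [Peripheral i 0] would be contractible and [Peripheral i 1] is isotopic to
   the boundary segment following i. *)
Definition essential (N : nat) (c : curve N) : bool :=
  match c with Bridging _ => true | Peripheral _ l => (1 < l)%N end.

(* Two curves cross (however they are drawn in their classes) iff some lift of
   one has its endpoints separated by those of some lift of the other; only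
   the relative translation t of the two lifts matters.  Common endpoints are
   not crossings. *)
Definition crosses (N : nat) (c d : curve N) : Prop :=
  match c, d with
  | Bridging _, Bridging _ => False
  | Bridging k, Peripheral i l | Peripheral i l, Bridging k =>
      exists t : int, i%:Z < k%:Z + t * N%:Z < i%:Z + l%:Z
  | Peripheral i l, Peripheral i' l' =>
      exists t : int,
        let x := i%:Z in let y := i%:Z + l%:Z in
        let x' := i'%:Z + t * N%:Z in let y' := x' + l'%:Z in
        (x < x' /\ x' < y /\ y < y') \/ (x' < x /\ x < y' /\ y' < y)
  end.

(* [crosses c c] means that c is self-crossing; for [Peripheral i l] this
   happens exactly when l > N. *)
Definition is_arc (N : nat) (c : curve N) : Prop :=
  essential c /\ ~ crosses c c.

(* No generality is lost by taking collections to be finite: there are only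
   finitely many arcs. *)
Definition triangulation (N : nat) (T : seq (curve N)) : Prop :=
  [/\ uniq T,
      forall c, c \in T -> is_arc c,
      forall c d, c \in T -> d \in T -> ~ crosses c d
    & forall c, is_arc c -> (forall d, d \in T -> ~ crosses c d) -> c \in T].

Definition arc_ends (N : nat) (c : curve N) (i : 'I_N) : nat :=
  match c with
  | Bridging k => (k == i)
  | Peripheral k l => ((k == i) + ((k + l) %% N == i))%N
  end.

Definition triangulation_sequence (N : nat) (T : seq (curve N)) : seq nat :=
  [seq (1 + \sum_(c <- T) arc_ends c i)%N | i <- enum 'I_N].

Definition arises_from_punctured_disc (m : int -> int -> int) : Prop :=
  exists (N : nat) (T : seq (curve N)),
    [/\ (0 < N)%N, triangulation T
      & quiddity_sequence m (triangulation_sequence T)].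

(* Main.v *)
Require Import Defs.
From mathcomp Require Import all_boot all_order all_algebra.
From mathcomp Require Import zify ring.

(* The entries of a frieze solve the recurrence [y (j - 1) + y (j + 1) = a j * y j]
   attached to the quiddity row [a], and the growth coefficients are the traces
   of the powers of its monodromy, an integral matrix of determinant 1; hence
   [s (k + 2) = s 1 * s (k + 1) - s k], and positivity forces [s 1 >= 2].  So
   [s k = 2] for a single [k > 0] already forces [s 1 = 2], which holds iff the
   recurrence has a nonzero periodic solution.

   A triangulation of the punctured disc provides a periodic solution: give the
   end of a bridging arc the value 1 and the middle vertex of a triangle the sum
   of the values at its outer corners.  Conversely, a positive periodic solution
   [v], made primitive, is the sequence of denominators of a path [u j / v j] of
   Farey neighbours, invariant under a translation; the edges of the Farey
   tessellation lying above this path form the triangulation. *)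

Set Implicit Arguments.
Unset Strict Implicit.
Unset Printing Implicit Defensive.

Import Order.TTheory GRing.Theory Num.Theory.
Local Open Scope ring_scope.

(** * The recurrence and its monodromy *)

Definition solution (a y : int -> int) : Prop :=
  forall j, y (j - 1) + y (j + 1) = a j * y j.

Lemma int_up_ind (P : int -> Prop) (i : int) :
  P i -> (forall j, i <= j -> P j -> P (j + 1)) -> forall j, i <= j -> P j.
Proof.
move=> P0 PS j le_ij; have -> : j = i + `|j - i|%N%:Z by lia.
elim: `|j - i|%N => [|k IHk]; first by rewrite addr0.
have -> : i + k.+1%:Z = i + k%:Z + 1 by lia.
by apply: PS => //; lia.
Qed.

Lemma int_down_ind (P : int -> Prop) (i : int) :
  P i -> (forall j, j < i -> P (j + 1) -> P j) -> forall j, j <= i -> P j.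
Proof.
move=> P0 PS j le_ji; have -> : j = i - `|j - i|%N%:Z by lia.
elim: `|j - i|%N => [|k IHk]; first by rewrite subr0.
apply: PS; first by lia.
by have -> : i - k.+1%:Z + 1 = i - k%:Z by lia.
Qed.

(** Uniqueness on a half-line: a row of a frieze is constrained only from its initial 0 onwards, so
    agreement with a two-sided solution is propagated upwards only. *)
Lemma solution_up (a x y : int -> int) (i : int) :
  x i = y i -> x (i + 1) = y (i + 1) ->
  (forall j : int, i < j -> x (j - 1) + x (j + 1) = a j * x j) ->
  (forall j : int, i < j -> y (j - 1) + y (j + 1) = a j * y j) ->
  forall j, i <= j -> x j = y j.
Proof.
move=> e0 e1 sx sy j le_ij.
suff: x j = y j /\ x (j + 1) = y (j + 1) by case.
move: j le_ij; apply: int_up_ind => // j le_ij [e2 e3]; split=> //.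
have lt_ij : i < j + 1 by lia.
by move: (sx _ lt_ij) (sy _ lt_ij); rewrite addrK e2 e3 => <- /addrI ->.
Qed.

Lemma solution_ext (a x y : int -> int) (i : int) :
  solution a x -> solution a y -> x i = y i -> x (i + 1) = y (i + 1) -> x =1 y.
Proof.
move=> sx sy e0 e1 j; have [le_ij|/ltW le_ji] := lerP i j.
  by apply: (@solution_up a x y i).
suff: x j = y j /\ x (j + 1) = y (j + 1) by case.
move: j le_ji; apply: int_down_ind => // j lt_ji [e2 e3]; split=> //.
by move: (sx (j + 1)) (sy (j + 1)); rewrite addrK e2 e3 => <- /addIr ->.
Qed.

Lemma periodicZ (R : Type) (f : int -> R) (d x t : int) :
  (forall x, f (x + d) = f x) -> f (x + t * d) = f x.
Proof.
move=> fP; have pos (k : nat) y : f (y + k%:Z * d) = f y.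
  elim: k => [|k IH]; first by rewrite mul0r addr0.
  by rewrite -[RHS]IH -[RHS]fP -addn1 PoszD mulrDl mul1r addrA.
have [t_ge0|/ltW t_le0] := lerP 0 t; first by rewrite -(pos `|t|%N x) gez0_abs.
by rewrite -(pos `|t|%N (x + _)) -addrA -mulrDl lez0_abs // addrN mul0r addr0.
Qed.

Fixpoint forward (a : int -> int) (p q : int) (k : nat) : int * int :=
  if k is k'.+1 then
    let: (y, y') := forward a p q k' in (y', a k'.+1%:Z * y' - y)
  else (p, q).

Lemma solution_exists (a : int -> int) (p q : int) :
  exists y, [/\ solution a y, y 0 = p & y 1 = q].
Proof.
(* The reflection [j |-> 1 - j] swaps the initial positions 0 and 1, so the negative half is again a
   forward run, started from [(q, p)]. *)
pose b (j : int) := a (1 - j).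
pose y (j : int) := if 0 <= j then (forward a p q `|j|%N).1
                    else (forward b q p (absz (1 - j)%R)).1.
have fwd c r s (k : nat) : (forward c r s k).1 + (forward c r s k.+2).1
                      = c k.+1%:Z * (forward c r s k.+1).1.
  by rewrite /=; case: (forward c r s k) => u u' /=; ring.
have ypos (k : nat) : y k%:Z = (forward a p q k).1 by [].
have yneg (k : nat) : y (1 - k%:Z) = (forward b q p k).1.
  rewrite /y; case: k => [|[|k]] //.
  have -> : (0 <= 1 - k.+2%:Z) = false by lia.
  by have -> : absz (1 - (1 - k.+2%:Z))%R = k.+2 by lia.
exists y; split=> // j; have [j_gt0|j_le0] := ltrP 0 j.
  have [k ->] : exists k : nat, j = k.+1%:Z by exists `|j - 1|%N; lia.
  have -> : k.+1%:Z - 1 = k%:Z by lia.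
  have -> : k.+1%:Z + 1 = k.+2%:Z by lia.
  by rewrite !ypos fwd.
have [k ->] : exists k : nat, j = 1 - k.+1%:Z by exists `|j|%N; lia.
have -> : 1 - k.+1%:Z - 1 = 1 - k.+2%:Z by lia.
have -> : 1 - k.+1%:Z + 1 = 1 - k%:Z by lia.
rewrite !yneg addrC fwd /b; congr (a _ * _); lia.
Qed.

Lemma solution_shift (a y : int -> int) (d : int) :
  (forall j, a (j + d) = a j) -> solution a y -> solution a (fun j => y (j + d)).
Proof.
move=> ad sy j; rewrite -ad -sy; congr (y _ + y _); lia.
Qed.

Lemma solution_lin (a x y : int -> int) (p q : int) :
  solution a x -> solution a y -> solution a (fun j => p * x j + q * y j).
Proof.
move=> sx sy j; have := sx j; have := sy j => ey ex.
have -> : a j * (p * x j + q * y j) = p * (a j * x j) + q * (a j * y j) by ring.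
rewrite -ex -ey; ring.
Qed.

(** A step of the recurrence acts on pairs of consecutive values with determinant 1, so this
    determinant of two solutions is conserved. *)
Lemma wronskian_const (a x y : int -> int) (i j : int) :
  solution a x -> solution a y ->
  x j * y (j + 1) - x (j + 1) * y j = x i * y (i + 1) - x (i + 1) * y i.
Proof.
move=> sx sy; pose w k := x k * y (k + 1) - x (k + 1) * y k.
have wS k : w (k + 1) = w k.
  rewrite /w; have := sx (k + 1); have := sy (k + 1); rewrite !addrK => ey ex.
  have -> : y (k + 1 + 1) = a (k + 1) * y (k + 1) - y k by rewrite -ey; ring.
  have -> : x (k + 1 + 1) = a (k + 1) * x (k + 1) - x k by rewrite -ex; ring.
  ring.
have [le_ij|/ltW le_ji] := lerP i j.
  by move: j le_ij; apply: int_up_ind => // k _; rewrite -/(w k) -/(w (k + 1)) wS.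
by move: j le_ji; apply: int_down_ind => // k _; rewrite -/(w k) -/(w (k + 1)) wS.
Qed.

(** * Monodromy over a period *)

Section Monodromy.
Variables (a X Z : int -> int).
Hypotheses (sX : solution a X) (sZ : solution a Z).
Hypotheses (X0 : X 0 = 0) (X1 : X 1 = 1) (Z0 : Z 0 = 1) (Z1 : Z 1 = 0).

Lemma solution_basis (y : int -> int) (j : int) :
  solution a y -> y j = y 1 * X j + y 0 * Z j.
Proof.
move=> sy; apply: (@solution_ext a y _ 0 sy (solution_lin _ _ sX sZ)) => /=.
  rewrite X0 Z0; ring.
rewrite add0r X1 Z1; ring.
Qed.

(** The shift by [L] acts on the plane of solutions with trace [X (L + 1) + Z L] and determinant 1.
    Both sides of its Cayley-Hamilton identity are solutions, so comparing them at 0 and 1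
    suffices. *)
Lemma cayley_hamilton (L : int) (y : int -> int) (j : int) :
  (forall j, a (j + L) = a j) -> solution a y ->
  y (j + L + L) = (X (L + 1) + Z L) * y (j + L) - y j.
Proof.
move=> aL sy; set t := X (L + 1) + _.
have wr : X (L + 1) * Z L - X L * Z (L + 1) = 1.
  by rewrite -[LHS]opprB (wronskian_const 0 L sX sZ) add0r X0 Z0 X1 Z1.
pose yL i := y (i + L); pose yLL i := y (i + L + L).
have syL : solution a yL by exact: solution_shift.
have syLL : solution a yLL by exact: (solution_shift aL syL).
have eL i : y (i + L) = y (L + 1) * X i + y L * Z i.
  have := @solution_basis _ i syL; rewrite /yL add0r => ->.
  by rewrite [1 + L]addrC.
have eL0 := @solution_basis y L sy; have eL1 := @solution_basis y (L + 1) sy.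
have -> : t * y (j + L) - y j = t * yL j + (-1) * y j by rewrite mulN1r.
apply: (@solution_ext a yLL _ 0 syLL (solution_lin t (-1) syL sy)); rewrite /yLL /yL.
  rewrite !add0r eL eL0 eL1 /t -[X in _ = _ + X]mulr1 -[X in _ = _ + _ * X]wr; ring.
rewrite !add0r -addrA [1 + L]addrC addrA [1 + L]addrC [L + 1 + L]addrC addrA.
have -> : L + L + 1 = L + 1 + L by ring.
rewrite eL eL1 eL0 /t -[X in _ = _ + X]mulr1 -[X in _ = _ + _ * X]wr; ring.
Qed.

End Monodromy.

(** By two adjacent determinants, [(m i (j - 2) + m i j) / m i (j - 1)] does not depend on the row
    [i <= j]; the row [i = j], which begins with 0 and 1, gives [m j j]. *)
Lemma frieze_recurrence (m : int -> int -> int) (i j : int) :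
  infinite_frieze m -> i <= j ->
  m i (j - 1 - 1) + m i j = m j j * m i (j - 1).
Proof.
case=> m0 m1 mpos mdet; move: i; apply: int_down_ind.
  by rewrite m1 mulr1 -[X in m j X + _]addrA -opprD m0 add0r.
move=> i lt_ij IH; apply: (@mulIf _ (m (i + 1) (j - 1))).
  by rewrite gt_eqF // mpos; lia.
have := mdet i (j - 1 - 1); have := mdet i (j - 1); rewrite !subrK.
move=> /(_ ltac:(lia)) d1 /(_ ltac:(lia)) d0.
have e1 : m i (j - 1) * m (i + 1) j = 1 + m i j * m (i + 1) (j - 1).
  by apply/eqP; rewrite -subr_eq d1.
have e0 : m i (j - 1 - 1) * m (i + 1) (j - 1)
   = 1 + m i (j - 1) * m (i + 1) (j - 1 - 1) by apply/eqP; rewrite -subr_eq d0.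
rewrite mulrDl e0 -[in RHS]mulrA [in RHS]mulrCA -IH mulrDr e1; ring.
Qed.

(* With [X] and [Z] the fundamental solutions, this is the trace of the
   monodromy [(y 0, y 1) |-> (y L, y (L + 1))] of the recurrence. *)
Definition monodromy_trace (X Z : int -> int) (L : nat) : int :=
  X (L%:Z + 1) + Z L%:Z.

(** [X] extends row 1 and [Z] extends minus row 2, each moved one place to the right, so that the
    difference defining a growth coefficient becomes a trace. *)
Lemma frieze_growth (m : int -> int -> int) (n : nat) :
  infinite_frieze m ->
  exists X Z : int -> int,
  [/\ solution (fun j => m j j) X /\ solution (fun j => m j j) Z,
      [/\ X 0 = 0, X 1 = 1, Z 0 = 1 & Z 1 = 0],
      forall j : int, 0 < j -> 0 < X j
    & forall k, (0 < n)%N ->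
        growth_coefficient m n k = monodromy_trace X Z (k * n)].
Proof.
move=> fm; case: (fm) => m0 m1 mpos _; set a := fun j => m j j.
have [X [sX X0 X1]] := solution_exists a 0 1.
have [Z [sZ Z0 Z1]] := solution_exists a 1 0.
have Z2 : Z 2 = -1.
  by have := sZ 1; rewrite subrr Z0 Z1 mulr0 => /eqP; rewrite addrC addr_eq0 => /eqP.
have eX (j : int) : 0 <= j -> m 1 (j - 1) = X j.
  apply: (@solution_up a (fun j => m 1 (j - 1))); rewrite ?X0 ?X1 //.
  by move=> k lt_k; rewrite addrK frieze_recurrence //; lia.
have eZ (j : int) : 1 <= j -> - m 2 (j - 1) = Z j.
  apply: (@solution_up a (fun j => - m 2 (j - 1))); rewrite ?Z1 ?Z2 //.
  - by rewrite (_ : 1 - 1 = 2 - 2 :> int) // m0 oppr0.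
  - by rewrite addrK (m1 2).
  by move=> k lt_k; rewrite addrK -opprD frieze_recurrence ?mulrN //; lia.
exists X, Z; split=> // [j j_gt0|k n_gt0].
  by rewrite -eX ?mpos //; lia.
rewrite /growth_coefficient /monodromy_trace; case: (posnP k) => [->|k_gt0].
  by rewrite mul0n add0r X1 Z0.
have kn_gt0 : (0 < k * n)%N by rewrite muln_gt0 k_gt0.
by rewrite -eX ?addrK -?eZ //; lia.
Qed.

(** * Growth coefficients as traces of powers of the monodromy *)

Section Growth.
Variables (a X Z : int -> int) (n : nat).
Hypotheses (sX : solution a X) (sZ : solution a Z).
Hypotheses (X0 : X 0 = 0) (X1 : X 1 = 1) (Z0 : Z 0 = 1) (Z1 : Z 1 = 0).
Hypothesis X_gt0 : forall j : int, 0 < j -> 0 < X j.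
Hypotheses (n_gt0 : (0 < n)%N) (a_per : forall j, a (j + n%:Z) = a j).

Let s (k : nat) : int := monodromy_trace X Z (k * n).

Lemma growth_rec (k : nat) : s k.+2 = s 1%N * s k.+1 - s k.
Proof.
have CH y j : solution a y -> y (j + n%:Z + n%:Z) = s 1%N * y (j + n%:Z) - y j.
  by move=> sy; rewrite (cayley_hamilton sX sZ) // /s /monodromy_trace mul1n.
rewrite {1}/s /monodromy_trace.
have -> : (k.+2 * n)%N%:Z + 1 = (k * n)%N%:Z + 1 + n%:Z + n%:Z by lia.
have -> : (k.+2 * n)%N%:Z = (k * n)%N%:Z + n%:Z + n%:Z by lia.
rewrite !CH //; set t := s 1%N; rewrite /s /monodromy_trace.
have -> : (k.+1 * n)%N%:Z + 1 = (k * n)%N%:Z + 1 + n%:Z by lia.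
have -> : (k.+1 * n)%N%:Z = (k * n)%N%:Z + n%:Z by lia.
ring.
Qed.

Lemma growth0 : s 0%N = 2.
Proof. by rewrite /s /monodromy_trace mul0n add0r X1 Z0. Qed.

(* If [s 1 = 1] the monodromy has order 6 and [X] changes sign; if [s 1 <= 0],
   already [X (1 + 2n) + X 1 <= 0]. *)
Lemma growth1_ge2 : 2 <= s 1%N.
Proof.
have CH j : X (j + n%:Z + n%:Z) = s 1%N * X (j + n%:Z) - X j.
  by rewrite (cayley_hamilton sX sZ) // /s /monodromy_trace mul1n.
have /X_gt0 p0 : 0 < 1 :> int by [].
have /X_gt0 p1 : 0 < 1 + n%:Z by lia.
have /X_gt0 p2 : 0 < 1 + n%:Z + n%:Z by lia.
have /X_gt0 p3 : 0 < 1 + n%:Z + n%:Z + n%:Z by lia.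
have e2 := CH 1; have e3 := CH (1 + n%:Z).
move: p0 p1 p2 p3 e2 e3; move: (s 1%N) (X _) (X _) (X _) (X _) => t x0 x1 x2 x3.
move=> p0 p1 p2 p3 e2 e3; have : t <> 1 by move=> t1; move: e2 e3; rewrite t1; lia.
have : 0 < t by rewrite ltNge; apply/negP => t0; nia.
lia.
Qed.

Lemma growth_eq2_all : s 1%N = 2 -> forall k, s k = 2.
Proof.
move=> s1 k; suff: s k = 2 /\ s k.+1 = 2 by case.
by elim: k => [|k [e0 e1]]; rewrite ?growth0 // growth_rec e0 e1 s1.
Qed.

(** If [s 1 > 2], the recursion makes [s] strictly increasing from [s 0 = 2], so the value 2 never
    returns. *)
Lemma growth_eq2_one (k : nat) : (0 < k)%N -> s k = 2 -> s 1%N = 2.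
Proof.
move=> k_gt0 sk; have := growth1_ge2; rewrite le_eqVlt => /orP[/eqP<- //|s1].
suff gt2 i : 2 <= s i < s i.+1.
  by case: k k_gt0 sk => // k _ sk; have := gt2 k; rewrite sk; lia.
elim: i => [|i IH]; first by rewrite growth0 s1 lexx.
by rewrite growth_rec; nia.
Qed.

(** A nonzero vector fixed by the monodromy turns Cayley-Hamilton into [2 y = t y], with [t] the
    trace. *)
Lemma periodic_solution_growth (y : int -> int) (j : int) :
  solution a y -> (forall i, y (i + n%:Z) = y i) -> y j != 0 -> s 1%N = 2.
Proof.
move=> sy yP yj; have := cayley_hamilton sX sZ X0 X1 Z0 Z1 j a_per sy.
have -> : X (n%:Z + 1) + Z n%:Z = s 1%N by rewrite /s /monodromy_trace mul1n.
rewrite !yP => /eqP; rewrite eq_sym subr_eq -mulr2n => /eqP e.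
by apply: (mulIf yj); rewrite e mulr_natl.
Qed.

(* [X (j + k n) = X j + k v j] stays positive, so [v >= 0]. *)
Lemma growth_eq2_periodic_solution : s 1%N = 2 ->
  exists v, [/\ solution a v, forall j, v (j + n%:Z) = v j & forall j, 0 < v j].
Proof.
move=> s1; pose v j := 1 * X (j + n%:Z) + (-1) * X j.
have sv : solution a v by apply: solution_lin => //; apply: solution_shift.
have vP j : v (j + n%:Z) = v j.
  rewrite /v (cayley_hamilton sX sZ) //.
  have -> : X (n%:Z + 1) + Z n%:Z = 2 by rewrite -s1 /s /monodromy_trace mul1n.
  ring.
have XE (j : int) (k : nat) : X (j + k%:Z * n%:Z) = X j + k%:Z * v j.
  elim: k => [|k IHk]; first by rewrite !mul0r !addr0.
  have := periodicZ j k vP; rewrite {1}/v IHk.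
  rewrite -addrA (_ : k%:Z * n%:Z + n%:Z = k.+1%:Z * n%:Z); last by lia.
  have -> : k.+1%:Z * v j = k%:Z * v j + v j by lia.
  by move: (X (j + _)) (X j) (v j) => x x0 w e; lia.
have v_pos_ge0 (j : int) : 0 < j -> 0 <= v j.
  move=> j_gt0; rewrite leNgt; apply/negP => v_lt0; have Xj := X_gt0 j_gt0.
  have : 0 < X (j + `|X j|%N%:Z * n%:Z) by apply: X_gt0; nia.
  by rewrite XE gez0_abs; nia.
have v_ge0 j : 0 <= v j.
  by rewrite -(periodicZ j `|j|.+1%N vP); apply: v_pos_ge0; nia.
have vn1 : v 0 != 0.
  by rewrite /v X0 mulr0 addr0 mul1r add0r gt_eqF // X_gt0.
(* At a zero of the nonnegative [v] the two neighbours sum to 0, hence vanish, and then [v] is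
   identically 0, against [v 0 = X n > 0]. *)
exists v; split=> // j; rewrite lt_def v_ge0 andbT; apply/eqP => v0.
case/eqP: vn1; apply: (@solution_ext a v (fun=> 0) j sv) => //.
  by move=> i; rewrite addr0 mulr0.
have := sv j; have := v_ge0 (j - 1); have := v_ge0 (j + 1); rewrite v0 mulr0.
by move: (v _) (v _) => *; lia.
Qed.

End Growth.

(** * Triangulations in the universal cover *)

(* A triangulation seen in the universal cover: [A x y] says that a lifted
   peripheral arc joins [x] to [y], and [B x] that a bridging arc ends at [x].
   The bound [y <= x + N] says that the arc does not cross its own
   translates. *)
Record lifted_triangulation (N : nat) (A : int -> int -> bool) (B : int -> bool)
    : Prop := LiftedTriangulation {
  arc_periodic : forall x y, A (x + N%:Z) (y + N%:Z) = A x y;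
  bridge_periodic : forall x, B (x + N%:Z) = B x;
  arc_length : forall x y, A x y -> x + 1 < y <= x + N%:Z;
  arc_noncrossing : forall x y x' y', A x y -> A x' y' ->
    x < x' -> x' < y -> y < y' -> False;
  bridge_noncrossing : forall x y b, A x y -> B b -> x < b -> b < y -> False;
  bridge_maximal : forall b,
    (forall x y, A x y -> x < b -> b < y -> False) -> B b;
  arc_maximal : forall x y, x + 1 < y -> y <= x + N%:Z ->
    (forall x' y', A x' y' -> x < x' -> x' < y -> y < y' -> False) ->
    (forall x' y', A x' y' -> x' < x -> x < y' -> y' < y -> False) ->
    (forall b, B b -> x < b -> b < y -> False) -> A x y
}.

(** Reflection exchanges the two ends of an arc, so statements about last neighbours also serve for
    first neighbours. *)
Lemma reflect_lifted (N : nat) (A : int -> int -> bool) (B : int -> bool) :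
  lifted_triangulation N A B ->
  lifted_triangulation N (fun x y => A (- y) (- x)) (fun x => B (- x)).
Proof.
case=> Aper Bper len AA AB maxB maxA; split.
- by move=> x y; rewrite -[LHS]Aper !opprD !subrK.
- by move=> x; rewrite -[LHS]Bper opprD subrK.
- by move=> x y /len; lia.
- by move=> x y x' y' Axy Ax'y' *; apply: (AA _ _ _ _ Ax'y' Axy); lia.
- by move=> x y b Axy Bb *; apply: (AB _ _ _ Axy Bb); lia.
- move=> b BB; apply: maxB => x y Axy *; apply: (BB (- y) (- x)).
  + by rewrite !opprK.
  + by lia.
  by lia.
move=> x y xy yN AA1 AA2 BB; apply: maxA; try lia.
- move=> x' y' Axy *; apply: (AA2 (- y') (- x')); rewrite ?opprK //; lia.
- move=> x' y' Axy *; apply: (AA1 (- y') (- x')); rewrite ?opprK //; lia.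
by move=> b Bb *; apply: (BB (- b)); rewrite ?opprK //; lia.
Qed.

Definition edge (A : int -> int -> bool) (x y : int) : bool :=
  (y == x + 1) || A x y.

Definition last_neighbour (N : nat) (A : int -> int -> bool) (i : int) : int :=
  i + (\max_(l < N.+1 | edge A i (i + l%:Z)%R) l)%N%:Z.

Definition first_neighbour (N : nat) (A : int -> int -> bool) (i : int) : int :=
  - last_neighbour N (fun x y => A (- y) (- x)) (- i).

Lemma int_last (P : int -> bool) (lo hi : int) : P lo -> lo < hi ->
  exists z, [/\ lo <= z < hi, P z & forall z', z < z' -> z' < hi -> ~~ P z'].
Proof.
move=> Plo lo_hi; have : lo + 1 <= hi by lia.
move: hi {lo_hi}; apply: int_up_ind.
  by exists lo; split=> // [|z' ? ?]; lia.
move=> hi lo_hi [z [z_in Pz zmax]]; case Phi: (P hi).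
  by exists hi; split=> // [|z' ? ?]; lia.
exists z; split=> // [|z' zz' z'hi]; first by lia.
have [->|neq] := eqVneq z' hi; first by rewrite Phi.
by apply: zmax => //; lia.
Qed.

(** A loop lifts to arcs from [i] to [i + N] and from [i - N] to [i], so each one-sided degree
    counts one of its two ends. *)
Definition right_degree (N : nat) (A : int -> int -> bool) (i : int) : nat :=
  \sum_(0 <= l < N.+1) A i (i + l%:Z)%R.
Definition left_degree (N : nat) (A : int -> int -> bool) (i : int) : nat :=
  \sum_(0 <= l < N.+1) A (i - l%:Z)%R i.
Definition degree N A (B : int -> bool) i : nat :=
  (1 + B i + right_degree N A i + left_degree N A i)%N.

(** * Fans of edges at a vertex *)

Section Fan.
Variables (N : nat) (A : int -> int -> bool) (B : int -> bool).
Hypotheses (N_gt0 : (0 < N)%N) (T : lifted_triangulation N A B).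

Lemma edge_bound (x y : int) : edge A x y -> x < y <= x + N%:Z.
Proof. by case/orP => [/eqP->|/(arc_length T)]; lia. Qed.

Lemma edge_noncrossing (x y x' y' : int) : edge A x y -> edge A x' y' ->
  x < x' -> x' < y -> y < y' -> False.
Proof.
case/orP => [/eqP->|Axy]; first by move=> _ ? ?; lia.
case/orP => [/eqP->|Ax'y']; first by move=> _ ? ?; lia.
exact: (arc_noncrossing T Axy Ax'y').
Qed.

Lemma last_neighbourP (i : int) : edge A i (last_neighbour N A i) /\
  forall y, edge A i y -> y <= last_neighbour N A i.
Proof.
split.
  rewrite /last_neighbour.
  have [|l El ->] := @eq_bigmax_cond _ (fun l : 'I_N.+1 => edge A i (i + l%:Z)%R) (@nat_of_ord _).
    apply/card_gt0P; exists (inord 1); rewrite unfold_in /=.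
    by rewrite inordK // /edge eqxx.
  by [].
move=> y Ey; have := edge_bound Ey => y_in.
have l_lt : (`|y - i| < N.+1)%N by lia.
have := @leq_bigmax_cond _ (fun l : 'I_N.+1 => edge A i (i + l%:Z)%R) (@nat_of_ord _) (Ordinal l_lt).
rewrite /= (_ : i + `|y - i|%N%:Z = y); last by lia.
rewrite /last_neighbour => /(_ Ey); move: (\max_(_ | _) _) => M; lia.
Qed.

(** The triangle below the arc [i y] has its third corner at the last [z < y] joined to [i]:
    whatever crossed [z y] would cross [i y] or [i z], or be an edge from [i] ending between [z] and
    [y]. *)
Lemma previous_neighbour (i y : int) : A i y ->
  exists z, [/\ i < z < y, edge A i z, edge A z y
              & forall z', z < z' -> z' < y -> ~~ edge A i z'].
Proof.
move=> Aiy; have y_in := arc_length T Aiy.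
have [|z [z_in Ez zmax]] := @int_last (edge A i) (i + 1) y _ ltac:(lia).
  by rewrite /edge eqxx.
exists z; split=> //; first by lia.
rewrite /edge; case: eqP => //= neq; apply: (arc_maximal T); try lia.
- by move=> x' y' A' *; apply: (arc_noncrossing T Aiy A'); lia.
- move=> x' y' A' x'z zy' y'y; have [lt|le] := ltrP x' i.
    by apply: (arc_noncrossing T A' Aiy); lia.
  have [e|ne] := eqVneq x' i.
    by have := zmax _ zy' y'y; rewrite /edge -e A' orbT.
  by apply: (@edge_noncrossing i z x' y'); rewrite // /edge ?A' ?orbT //; lia.
by move=> b Bb *; apply: (bridge_noncrossing T Aiy Bb); lia.
Qed.

(* The defining relation of a lambda length to the puncture: [v] is the sum of
   its values at the two outer corners of each triangle [x < i < y]. *)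
Definition puncture_length (v : int -> int) : Prop :=
  (forall i, B i -> v i = 1) /\
  forall x i y, edge A x i -> edge A i y -> A x y -> v i = v x + v y.

(** In the triangle [i < z < y] on consecutive edges from [i], [v z = v i + v y]; each arc
    contributes one [v i], and the relations telescope from [i + 1] to the last neighbour. *)
Lemma right_fan (v : int -> int) (i : int) : puncture_length v ->
  v (i + 1) = (right_degree N A i)%:Z * v i + v (last_neighbour N A i).
Proof.
case=> _ vtri.
have A0 : A i (i + 0%:Z) = false by apply/negP => /(arc_length T); lia.
have A1 : A i (i + 1%:Z) = false by apply/negP => /(arc_length T); lia.
suff fan k : edge A i (i + k%:Z) ->
    v (i + 1) = (\sum_(0 <= l < k.+1) A i (i + l%:Z)%R)%N%:Z * v i + v (i + k%:Z).
  have [Elast lastmax] := last_neighbourP i.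
  have := edge_bound Elast => last_in.
  have lastE : last_neighbour N A i = i + `|last_neighbour N A i - i|%N%:Z by lia.
  rewrite lastE in Elast; rewrite lastE (fan _ Elast) /right_degree.
  congr (_%:Z * _ + _); rewrite [in RHS](@big_cat_nat _ _ _ (`|last_neighbour N A i - i|).+1) //=; last by lia.
  rewrite -[LHS]addn0; congr addn; rewrite big_nat big1 // => l l_in.
  case Al: (A i _) => //; have := lastmax (i + l%:Z); rewrite /edge Al orbT.
  by move=> /(_ isT); lia.
elim/ltn_ind: k => k IH; case/orP => [/eqP e|Ak].
  have -> : k = 1%N by lia.
  by rewrite !big_nat_recr //= big_nil A0 A1 mul0r add0r.
have [z [z_in Ez Ezk zmax]] := previous_neighbour Ak.
have zE : z = i + `|z - i|%N%:Z by lia.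
set k' := `|z - i|%N in zE; have lt_k : (k' < k)%N by lia.
rewrite zE in Ez; rewrite (IH _ lt_k Ez) -zE (vtri i z (i + k%:Z)) -?zE //; last by rewrite zE.
rewrite [in RHS]big_nat_recr //= Ak [in RHS](@big_cat_nat _ _ _ k'.+1) //=.
have -> : (\sum_(k'.+1 <= l < k) A i (i + l%:Z)%R = 0)%N; last first.
  by rewrite addn0 PoszD; ring.
rewrite big_nat big1 // => l l_in; case Al: (A i _) => //; have := zmax (i + l%:Z).
by rewrite /edge Al orbT => /(_ ltac:(lia) ltac:(lia)).
Qed.

(** Without a bridge at [i] some arc passes above [i], and it spans [x] and [y] too, since it cannot
    cross the outermost edges at [i]. It bounds the length of [x y]; an arc crossing [x y] would
    cross one of these edges or end at [i] beyond them. *)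
Lemma spanning_edge (x i y : int) : edge A x i -> edge A i y ->
  (forall z, edge A i z -> z <= y) -> (forall z, edge A z i -> x <= z) ->
  ~~ B i -> A x y.
Proof.
move=> Exi Eiy ymax xmin nBi; apply/negPn/negP => nAxy; case/negP: nBi.
apply: (bridge_maximal T) => x0 y0 A0 x0i iy0; case/negP: nAxy.
have E0 : edge A x0 y0 by rewrite /edge A0 orbT.
have := edge_bound Exi; have := edge_bound Eiy => y_in x_in.
have x0x : x0 <= x.
  by rewrite leNgt; apply/negP => lt; apply: (edge_noncrossing Exi E0); lia.
have yy0 : y <= y0.
  by rewrite leNgt; apply/negP => lt; apply: (edge_noncrossing E0 Eiy); lia.
have := arc_length T A0 => len0.
apply: (arc_maximal T); [lia|lia| | |].
- move=> x' y' A' xx' x'y yy'; have E' : edge A x' y' by rewrite /edge A' orbT.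
  have [lt|gt|e] := ltrgtP x' i.
  + by apply: (edge_noncrossing Exi E'); lia.
  + by apply: (edge_noncrossing Eiy E'); lia.
  by rewrite e in E'; have := ymax _ E'; lia.
- move=> x' y' A' x'x xy' y'y; have E' : edge A x' y' by rewrite /edge A' orbT.
  have [lt|gt|e] := ltrgtP y' i.
  + by apply: (edge_noncrossing E' Exi); lia.
  + by apply: (edge_noncrossing E' Eiy); lia.
  by rewrite e in E'; have := xmin _ E'; lia.
move=> b Bb xb yb; have [lt|gt|e] := ltrgtP b i.
- case/orP: Exi => [/eqP|Axi]; first by lia.
  by apply: (bridge_noncrossing T Axi Bb); lia.
- case/orP: Eiy => [/eqP|Aiy]; first by lia.
  by apply: (bridge_noncrossing T Aiy Bb); lia.
have B0 : B i by rewrite -e.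
by apply: (bridge_noncrossing T A0 B0); lia.
Qed.

(** The region to the right of a bridge at [i] is the triangle on [i], its last neighbour and the
    puncture. *)
Lemma last_neighbour_bridge (i : int) : B i -> B (last_neighbour N A i).
Proof.
move=> Bi; have [Eiy ymax] := last_neighbourP i; set y := last_neighbour N A i in Eiy ymax *.
apply: (bridge_maximal T) => x0 y0 A0 x0y yy0.
have E0 : edge A x0 y0 by rewrite /edge A0 orbT.
have := edge_bound Eiy => y_in; have [lt|gt|e] := ltrgtP x0 i.
- by apply: (bridge_noncrossing T A0 Bi); lia.
- by apply: (edge_noncrossing Eiy E0); lia.
by rewrite e in E0; have := ymax _ E0; lia.
Qed.

End Fan.

Section FanBothSides.
Variables (N : nat) (A : int -> int -> bool) (B : int -> bool).
Hypotheses (N_gt0 : (0 < N)%N) (T : lifted_triangulation N A B).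

Let A' (x y : int) := A (- y) (- x).

Lemma edge_reflect (x y : int) : edge A' x y = edge A (- y) (- x).
Proof. by rewrite /edge; congr (_ || _); apply/eqP/eqP; lia. Qed.

Lemma first_neighbourP (i : int) : edge A (first_neighbour N A i) i /\
  forall x, edge A x i -> first_neighbour N A i <= x.
Proof.
have [E xmin] := last_neighbourP N_gt0 (reflect_lifted T) (- i).
rewrite -/A' edge_reflect opprK in E; split=> // x Ex.
by rewrite lerNl; apply: xmin; rewrite -/A' edge_reflect !opprK.
Qed.

Lemma left_fan (v : int -> int) (i : int) : puncture_length A B v ->
  v (i - 1) = (left_degree N A i)%:Z * v i + v (first_neighbour N A i).
Proof.
case=> vB vtri.
have pv' : puncture_length A' (fun x => B (- x)) (fun j => v (- j)).
  split=> [j /vB //|x j y]; rewrite !edge_reflect => E1 E2 E3.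
  by rewrite addrC; apply: vtri.
have := right_fan N_gt0 (reflect_lifted T) (- i) pv'.
rewrite opprD !opprK => ->; congr (_%:Z * _ + _).
by apply: eq_bigr => l _; rewrite /A' opprD !opprK.
Qed.

(** The two fans leave over the values at the first and last neighbours of [i]. Their sum is [v i]
    when these span a triangle, and [1 + 1 = 2 v i] when a bridge ends at [i], hence also at both of
    them. *)
Lemma puncture_length_solution (v : int -> int) :
  puncture_length A B v -> solution (fun i => (degree N A B i)%:Z) v.
Proof.
move=> pv i; rewrite (right_fan N_gt0 T _ pv) (left_fan _ pv) /degree.
case: pv => vB vtri; have [Ey ymax] := last_neighbourP N_gt0 T i.
have [Ex xmin] := first_neighbourP i; case Bi: (B i).
  rewrite (vB _ (last_neighbour_bridge N_gt0 T Bi)).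
  have -> : v (first_neighbour N A i) = 1.
    apply: vB; have := @last_neighbour_bridge _ _ _ N_gt0 (reflect_lifted T) (- i).
    by rewrite opprK; apply.
  by rewrite (vB _ Bi) !PoszD /=; ring.
have := vtri _ _ _ Ex Ey (spanning_edge N_gt0 T Ex Ey ymax xmin (negbT Bi)).
by rewrite addrACA [v _ + v _]addrC => <-; rewrite !PoszD /=; ring.
Qed.

(** The recursion climbs from a middle vertex to the outer corners of its triangle until it meets
    bridges; the fuel stands in for the growing length of the triangles. *)
Fixpoint puncture_length_fuel (k : nat) (i : int) : int :=
  if k is k'.+1 then
    if B i then 1 else
      puncture_length_fuel k' (first_neighbour N A i)
      + puncture_length_fuel k' (last_neighbour N A i)
  else 1.

Let len i := last_neighbour N A i - first_neighbour N A i.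

(** An edge at [i] reaching beyond [x] or [y] would cross the arc [x y]. *)
Lemma triangle_neighbours (x i y : int) :
  edge A x i -> edge A i y -> A x y ->
  [/\ x = first_neighbour N A i, y = last_neighbour N A i & ~~ B i].
Proof.
move=> Ex Ey Axy; have [E1 ymax] := last_neighbourP N_gt0 T i.
have [E2 xmin] := first_neighbourP i.
have := edge_bound N_gt0 T Ex; have := edge_bound N_gt0 T Ey => y_in x_in.
have Exy : edge A x y by rewrite /edge Axy orbT.
split.
- apply/eqP; rewrite eq_le xmin // andbT leNgt; apply/negP => lt.
  by apply: (edge_noncrossing N_gt0 T E2 Exy); lia.
- apply/eqP; rewrite eq_le ymax //= leNgt; apply/negP => lt.
  by apply: (edge_noncrossing N_gt0 T Exy E1); lia.
by apply/negP => Bi; apply: (bridge_noncrossing T Axy Bi); lia.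
Qed.

Lemma neighbour_triangle (i : int) : ~~ B i ->
  A (first_neighbour N A i) (last_neighbour N A i).
Proof.
have [E1 ymax] := last_neighbourP N_gt0 T i; have [E2 xmin] := first_neighbourP i.
exact: (spanning_edge N_gt0 T E2 E1 ymax xmin).
Qed.

Lemma len_first (i : int) : ~~ B i -> ~~ B (first_neighbour N A i) ->
  len i < len (first_neighbour N A i).
Proof.
move=> /neighbour_triangle; rewrite /len; set x := first_neighbour N A i => Axy _.
have [E1 ymax] := last_neighbourP N_gt0 T x; have [E2 _] := first_neighbourP x.
have := edge_bound N_gt0 T E2 => x_in.
have := ymax (last_neighbour N A i); rewrite /edge Axy orbT => /(_ isT); lia.
Qed.

Lemma len_last (i : int) : ~~ B i -> ~~ B (last_neighbour N A i) ->
  len i < len (last_neighbour N A i).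
Proof.
move=> /neighbour_triangle; rewrite /len; set y := last_neighbour N A i => Axy _.
have [E1 _] := last_neighbourP N_gt0 T y; have [E2 xmin] := first_neighbourP y.
have := edge_bound N_gt0 T E1 => y_in.
have := xmin (first_neighbour N A i); rewrite /edge Axy orbT => /(_ isT); lia.
Qed.

(* The triangles whose middle vertices are the outer corners of the triangle at
   [i] are strictly longer, and all have length at most [N]. *)
Lemma puncture_length_fuel_stable (k : nat) (i : int) :
  B i \/ N%:Z < len i + k%:Z ->
  puncture_length_fuel k i = puncture_length_fuel k.+1 i.
Proof.
elim: k i => [|k IH] i hyp; rewrite [RHS]/=; case: ifPn => Bi.
- by [].
- have := arc_length T (neighbour_triangle Bi); rewrite -/(len i).
  by case: hyp => [Bi'|]; [rewrite Bi' in Bi | rewrite /len; lia].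
- by rewrite /= Bi.
rewrite [LHS]/= (negbTE Bi); case: hyp => [Bi'|lt]; first by rewrite Bi' in Bi.
congr (_ + _); rewrite IH //.
- case Bx: (B (first_neighbour N A i)); [by left | right].
  by have := len_first Bi (negbT Bx); lia.
case By: (B (last_neighbour N A i)); [by left | right].
by have := len_last Bi (negbT By); lia.
Qed.

Lemma last_neighbour_periodic (i : int) :
  last_neighbour N A (i + N%:Z) = last_neighbour N A i + N%:Z.
Proof.
have shift x y : edge A (x + N%:Z) (y + N%:Z) = edge A x y.
  by rewrite /edge (arc_periodic T) addrAC (inj_eq (addIr _)).
rewrite /last_neighbour addrAC; congr (_ + _%:Z + _).
by apply: eq_bigl => l; rewrite addrAC shift.
Qed.

End FanBothSides.

Lemma first_neighbour_periodic (N : nat) (A : int -> int -> bool) (B : int -> bool) (i : int) :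
  lifted_triangulation N A B ->
  first_neighbour N A (i + N%:Z) = first_neighbour N A i + N%:Z.
Proof.
move=> T; have := last_neighbour_periodic (reflect_lifted T) (- (i + N%:Z)).
by rewrite opprD subrK /first_neighbour => ->; rewrite !opprD subrK.
Qed.

Lemma puncture_length_exists (N : nat) (A : int -> int -> bool) (B : int -> bool) :
  (0 < N)%N -> lifted_triangulation N A B ->
  exists v, [/\ puncture_length A B v, forall i, v (i + N%:Z) = v i
              & forall i, 0 < v i].
Proof.
move=> N_gt0 T; pose v := puncture_length_fuel N A B N.+1.
have stable i : v i = puncture_length_fuel N A B N.+2 i.
  apply: puncture_length_fuel_stable => //; right.
  have [E1 _] := last_neighbourP N_gt0 T i; have [E2 _] := first_neighbourP N_gt0 T i.
  by have := edge_bound N_gt0 T E1; have := edge_bound N_gt0 T E2; lia.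
exists v; split.
- split=> [i Bi|x i y Ex Ey Axy]; first by rewrite stable /= Bi.
  have [ex ey Bi] := triangle_neighbours N_gt0 T Ex Ey Axy.
  by rewrite stable [LHS]/= (negbTE Bi) -ex -ey.
- rewrite /v => i; elim: N.+1 i => //= k IH i.
  rewrite (bridge_periodic T) (first_neighbour_periodic _ T).
  by rewrite (last_neighbour_periodic T) !IH.
move=> i; rewrite /v; elim: N.+1 i => //= k IH i.
by case: ifP => // _; apply: addr_gt0.
Qed.

(** * Farey paths *)

Lemma pos_factor1 (x y : int) : 0 < y -> x * y = 1 -> y = 1.
Proof.
move=> y_gt0 xy; have x_gt0 : 0 < x by rewrite -(pmulr_lgt0 _ y_gt0) xy.
nia.
Qed.

(** For positive denominators it is positive when [u i / v i < u j / v j], and then equals 1 exactly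
    for Farey neighbours. *)
Definition farey_det (u v : int -> int) (i j : int) : int := u j * v i - u i * v j.

(** Over a period the fractions [u j / v j] move by a constant, so only [v] and the determinants are
    periodic. *)
Record farey_path (n : nat) (u v : int -> int) : Prop := FareyPath {
  farey_step : forall j, farey_det u v j (j + 1) = 1;
  denominator_gt0 : forall j, 0 < v j;
  denominator_periodic : forall j, v (j + n%:Z) = v j;
  farey_det_periodic : forall i j,
    farey_det u v (i + n%:Z) (j + n%:Z) = farey_det u v i j
}.

Lemma reflect_farey_det (u v : int -> int) (i j : int) :
  farey_det (fun k => - u (- k)) (fun k => v (- k)) i j = farey_det u v (- j) (- i).
Proof. rewrite /farey_det; ring. Qed.

Lemma reflect_farey_path (n : nat) (u v : int -> int) : farey_path n u v ->
  farey_path n (fun k => - u (- k)) (fun k => v (- k)).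
Proof.
case=> W v_gt0 vP DP; split=> [j|j|j|i j]; rewrite ?reflect_farey_det //.
- by rewrite -[X in farey_det _ _ _ X](subrK 1) -opprD W.
- by rewrite -[LHS]vP opprD subrK.
by rewrite -[LHS]DP !opprD !subrK.
Qed.

Section FareyPath.
Variables (n : nat) (u v : int -> int).
Hypotheses (n_gt0 : (0 < n)%N) (P : farey_path n u v).
Local Notation D := (farey_det u v).

Lemma plucker (i j k l : int) : D i k * D j l = D i j * D k l + D i l * D j k.
Proof. rewrite /farey_det; ring. Qed.

(** The Plucker relation whose fourth vector is [(1, 0)], the cusp at infinity standing for the
    puncture. *)
Lemma plucker_bridge (i j k : int) : v j * D i k = D i j * v k + D j k * v i.
Proof. rewrite /farey_det; ring. Qed.

Lemma farey_det_gt0 (i j : int) : i < j -> 0 < D i j.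
Proof.
move=> ij; have {ij} : i + 1 <= j by lia.
move: j; apply: int_up_ind => [|j le_ij Dij]; first by rewrite (farey_step P).
have vj := denominator_gt0 P j; rewrite -(pmulr_rgt0 _ vj) plucker_bridge.
by rewrite (farey_step P) mul1r addr_gt0 ?mulr_gt0 ?(denominator_gt0 P).
Qed.

(** The left side of the Plucker relation would be 1, the right side a sum of two products of
    positive integers. *)
Lemma farey_noncrossing (i j k l : int) : i < j -> j < k -> k < l ->
  D i k = 1 -> D j l = 1 -> False.
Proof.
move=> ij jk kl Dik Djl; have := plucker i j k l; rewrite Dik Djl.
have := farey_det_gt0 ij; have := farey_det_gt0 jk; have := farey_det_gt0 kl.
have : 0 < D i l by apply: farey_det_gt0; lia.
by move: (D _ _) (D _ _) (D _ _) (D _ _) => *; nia.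
Qed.

Lemma farey_bridge_noncrossing (i j k : int) : i < j -> j < k ->
  D i k = 1 -> v j = 1 -> False.
Proof.
move=> ij jk Dik vj; have := plucker_bridge i j k; rewrite Dik vj.
have := farey_det_gt0 ij; have := farey_det_gt0 jk.
have := denominator_gt0 P i; have := denominator_gt0 P k.
by move: (D _ _) (D _ _) (v _) (v _) => *; nia.
Qed.

(* With [w j = (u j, v j)], the vector [z = w y - w i] is a Farey neighbour of
   [w i] to the right of [w y]; the path moves along Farey edges, so it cannot
   jump over [z]. *)
Lemma farey_descent (i y : int) : i < y -> D i y = 1 -> v i < v y ->
  exists y', [/\ y < y', D i y' = 1 & v y' = v y - v i].
Proof.
(* [f j] is the determinant of [w j] with [w y - w i], positive while the path stays to the left of
   that vector. *)
move=> iy Diy viy; pose f j := D i j - D y j.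
have fy : f y = 1 by rewrite /f Diy /farey_det subrr subr0.
(* One period later the denominator is the same and the numerator larger, so the vector has been
   reached or passed. *)
have fyn : f (y + n%:Z) <= 0.
  have /farey_det_gt0 : y < y + n%:Z by lia.
  rewrite /f /farey_det (denominator_periodic P) in Diy *.
  move: (u (y + _)) (u y) (u i) (v i) (v y) (denominator_gt0 P y) Diy viy.
  move=> un uy ui vi vy vy0 Diy viy e0.
  have e1 : 0 < un - uy by nia.
  have : 0 < (un - uy) * (vy - vi) by apply: mulr_gt0; lia.
  lia.
have [|z [z_in fz zmax]] := @int_last (fun j => 0 < f j) y (y + n%:Z) _ ltac:(lia).
  by rewrite fy.
have fz1 : f (z + 1) <= 0.
  have [e|ne] := eqVneq (z + 1) (y + n%:Z); first by rewrite e.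
  by rewrite leNgt; apply: zmax; lia.
have Wz : D z (z + 1) = 1 := farey_step P z.
have Diz : 0 < D i z by apply: farey_det_gt0; lia.
have Diz1 : 0 < D i (z + 1) by apply: farey_det_gt0; lia.
(* The left side is 1 and the last product at least 1, so the other term, being nonnegative,
   vanishes. *)
have jump : D i y * D z (z + 1) = - (D i z * f (z + 1)) + D i (z + 1) * f z.
  rewrite /f /farey_det; ring.
have f0 : f (z + 1) = 0.
  move: jump fz1 fz Diz Diz1; rewrite Diy Wz.
  by move: (f _) (f _) (D _ _) (D _ _) => *; nia.
rewrite f0 mulr0 oppr0 add0r Diy Wz in jump.
have Dj : D i (z + 1) = 1.
  by move: jump fz Diz1; move: (f _) (D _ _) => *; nia.
exists (z + 1); split=> //; first by lia.
have := plucker_bridge i y (z + 1).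
have : D y (z + 1) = 1 by move: f0; rewrite /f Dj; lia.
by rewrite Dj Diy => ->; lia.
Qed.

(** Repeated subtraction of [v i] is a Euclidean descent; it cannot stop at [v y = v i], for then
    [v i] would divide [D i y = 1]. *)
Lemma farey_small_neighbour (i y : int) : i < y -> D i y = 1 -> v i != 1 ->
  exists z, [/\ i < z, D i z = 1 & v z < v i].
Proof.
move=> iy Diy vi; have vi_gt0 := denominator_gt0 P i.
have [k] := ubnP `|v y|%N; elim: k y iy Diy => // k IH y iy Diy vyk.
have vy_gt0 := denominator_gt0 P y.
have [lt|gt|e] := ltrgtP (v y) (v i); first by exists y.
  have [y' [yy' Diy' vy']] := farey_descent iy Diy gt.
  by apply: (IH y') => //; lia.
case/eqP: vi; move: Diy; rewrite /farey_det e.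
by rewrite -mulrBl => /(pos_factor1 vi_gt0)->.
Qed.

End FareyPath.

Lemma reflected_small_neighbour (n : nat) (u v : int -> int) (i x : int) :
  (0 < n)%N -> farey_path n u v ->
  x < i -> farey_det u v x i = 1 -> v i != 1 ->
  exists z, [/\ z < i, farey_det u v z i = 1 & v z < v i].
Proof.
move=> n_gt0 P xi Dxi vi.
have [|||z []] := farey_small_neighbour n_gt0 (reflect_farey_path P) (i := - i) (y := - x).
- by lia.
- by rewrite reflect_farey_det !opprK.
- by rewrite opprK.
rewrite reflect_farey_det !opprK => iz Dz vz; exists (- z); split=> //; lia.
Qed.

Lemma reflected_descent (n : nat) (u v : int -> int) (i x : int) :
  (0 < n)%N -> farey_path n u v ->
  x < i -> farey_det u v x i = 1 -> v i < v x ->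
  exists2 x', x' < x & farey_det u v x' i = 1.
Proof.
move=> n_gt0 P xi Dxi vi.
have [|||z []] := farey_descent n_gt0 (reflect_farey_path P) (i := - i) (y := - x).
- by lia.
- by rewrite reflect_farey_det !opprK.
- by rewrite !opprK.
by rewrite reflect_farey_det !opprK => iz Dz _; exists (- z) => //; lia.
Qed.

(** * The triangulation above a Farey path *)

Section FareyTriangulation.
Variables (n : nat) (u v : int -> int).
Hypotheses (n_gt0 : (0 < n)%N) (P : farey_path n u v).
Local Notation D := (farey_det u v).

Definition farey_arc (x y : int) : bool := (x + 1 < y) && (D x y == 1).
Definition farey_bridge (x : int) : bool := v x == 1.

(** These are smaller neighbours on both sides; [v b * D x y = v x + v y < 2 v b] then forces
    [D x y = 1]. *)
Lemma farey_parents (b : int) : v b != 1 ->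
  exists x y, [/\ x < b, b < y, D b y = 1, v y < v b & D x y = 1].
Proof.
move=> vb; have Wb := farey_step P b; have Wb1 := farey_step P (b - 1).
rewrite subrK in Wb1.
have [|y [by_ Dby vy]] := farey_small_neighbour n_gt0 P _ Wb vb; first by lia.
have [|x [xb Dxb vx]] := reflected_small_neighbour n_gt0 P _ Wb1 vb; first by lia.
exists x, y; split=> //; have := plucker_bridge u v x b y; rewrite Dby Dxb !mul1r.
have := denominator_gt0 P x; have := denominator_gt0 P y.
by move: (D _ _) (v x) (v y) (v b) vx vy => *; nia.
Qed.

Lemma farey_lifted : lifted_triangulation n farey_arc farey_bridge.
Proof.
have arcN x y : farey_arc x y -> x + 1 < y /\ D x y = 1.
  by case/andP => ? /eqP.
have AA x y x' y' : farey_arc x y -> farey_arc x' y' -> x < x' -> x' < y -> y < y' -> False.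
  by move=> /arcN[_ Dxy] /arcN[_ Dx'y'] *; apply: (@farey_noncrossing _ _ _ n_gt0 P x x' y y').
have AP x y : farey_arc (x + n%:Z) (y + n%:Z) = farey_arc x y.
  by rewrite /farey_arc (farey_det_periodic P) addrAC ltrD2r.
split=> //.
- by move=> x; rewrite /farey_bridge (denominator_periodic P).
- move=> x y Axy; case: (arcN _ _ Axy) => -> _ /=; rewrite leNgt; apply/negP => lt.
  have Axy' : farey_arc (x + n%:Z) (y + n%:Z) by rewrite AP.
  by apply: (AA _ _ _ _ Axy Axy'); lia.
- move=> x y b /arcN[_ Dxy] /eqP vb *.
  by apply: (@farey_bridge_noncrossing _ _ _ n_gt0 P x b y).
- move=> b BB; apply/negPn/negP => /farey_parents[x [y [xb by_ _ _ Dxy]]].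
  by apply: (BB x y) => //; rewrite /farey_arc Dxy eqxx andbT; lia.
move=> x y xy _ AA1 AA2 BB; rewrite /farey_arc xy /=; apply/eqP.
(* A walk along the Farey neighbours of [x], starting at [x + 1]: while short of [y] it finds a next
   one no further than [y], so it ends at [y]. *)
suff step k : x < k -> k < y -> D x k = 1 -> exists z, [/\ k < z, z <= y & D x z = 1].
  have {}step (d : nat) k : x < k -> k <= y -> D x k = 1 -> `|y - k|%N = d -> D x y = 1.
    elim/ltn_ind: d k => d IH k xk; rewrite le_eqVlt => /orP[/eqP-> //|ky] Dxk dE.
    have [z [kz zy Dxz]] := step k xk ky Dxk.
    by apply: (IH `|y - z|%N _ z) => //; lia.
  by apply: (step _ (x + 1)); rewrite ?(farey_step P) //; lia.
move=> xk ky Dxk.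
have vk : v k != 1 by apply/negP => vk; apply: (BB k).
have [_ [z [_ kz Dkz vz _]]] := farey_parents vk.
have zy : z <= y.
  rewrite leNgt; apply/negP => yz; apply: (AA1 k z) => //.
  by rewrite /farey_arc Dkz eqxx andbT; lia.
have vx_gt0 := denominator_gt0 P x; have vk_gt0 := denominator_gt0 P k.
have vz_gt0 := denominator_gt0 P z.
exists z; split=> //; have := plucker_bridge u v x k z; rewrite Dxk Dkz !mul1r.
(* If [v x < v k], then [v k * D x z = v x + v z < 2 v k]. If [v x > v k], descent at [k] yields an
   arc to [k] from the left of [x], crossing [x y]. Equality would force [v k = 1]. *)
have [lt|gt|e] := ltrgtP (v x) (v k).
- by move: (D _ _) (v x) (v k) (v z) lt vx_gt0 vk_gt0 vz_gt0 vz => *; nia.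
- have [x' x'x Dx'k] := reflected_descent n_gt0 P xk Dxk gt.
  exfalso; apply: (AA2 x' k) => //.
  by rewrite /farey_arc Dx'k eqxx andbT; lia.
case/eqP: vk; move: Dxk; rewrite /farey_det e.
by rewrite -mulrBl => /(pos_factor1 vk_gt0)->.
Qed.

Lemma farey_puncture_length : puncture_length farey_arc farey_bridge v.
Proof.
have edgeD x y : edge farey_arc x y -> D x y = 1.
  by case/orP => [/eqP->|/andP[_ /eqP //]]; apply: (farey_step P).
split=> [i /eqP //|x i y /edgeD Dxi /edgeD Diy /andP[_ /eqP Dxy]].
by have := plucker_bridge u v x i y; rewrite Dxi Diy Dxy !mul1r mulr1 addrC.
Qed.

End FareyTriangulation.

(* Dividing [v] by the gcd of its entries makes it the denominator sequence of
   a Farey path, whose numerators come from Bezout's identity. *)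
Lemma periodic_solution_triangulation (n : nat) (a v : int -> int) :
  (0 < n)%N -> solution a v -> (forall j, a (j + n%:Z) = a j) ->
  (forall j, v (j + n%:Z) = v j) -> (forall j, 0 < v j) ->
  exists A B, lifted_triangulation n A B /\ forall j, (degree n A B j)%:Z = a j.
Proof.
move=> n_gt0 sv aP vP v_gt0.
have [w [sw w_gt0 wP [p [q bez]]]] : exists w, [/\ solution a w, forall j, 0 < w j,
    forall j, w (j + n%:Z) = w j & exists p q, p * w 0 + q * w 1 = 1].
  set g := gcdz (v 0) (v 1).
  have g_gt0 : 0 < g by rewrite lt_def gcdz_eq0 gt_eqF.
  (* Dividing only the two initial values and running the recurrence gives an integral [w];
     uniqueness then yields [v = g w] everywhere. *)
  have [w [sw w0 w1]] := solution_exists a (v 0 %/ g)%Z (v 1 %/ g)%Z.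
  have wE j : v j = g * w j.
    apply: (@solution_ext a v (fun j => g * w j) 0 sv).
    - by move=> i; rewrite mulrCA -sw mulrDr.
    - by rewrite w0 mulrC divzK ?dvdz_gcdl.
    by rewrite add0r w1 mulrC divzK ?dvdz_gcdr.
  exists w; split=> // [j|j|].
  - by rewrite -(pmulr_rgt0 _ g_gt0) -wE.
  - by apply: (mulfI (lt0r_neq0 g_gt0)); rewrite -!wE vP.
  have [p [q bez]] := Bezoutz (v 0) (v 1); exists p, q.
  apply: (mulfI (lt0r_neq0 g_gt0)); rewrite mulr1 -[RHS]bez (wE 0) (wE 1); ring.
(* These values make [u 1 * w 0 - u 0 * w 1] the Bezout combination, which is 1. *)
have [u [su u0 u1]] := solution_exists a (- q) p.
have W j : farey_det u w j (j + 1) = 1.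
  rewrite /farey_det; have := wronskian_const 0 j su sw.
  rewrite add0r u0 u1 => e; apply: etrans bez; rewrite -[LHS]opprB e; ring.
have sD i : solution a (farey_det u w i).
  move=> j; rewrite /farey_det.
  transitivity ((u (j - 1) + u (j + 1)) * w i - u i * (w (j - 1) + w (j + 1))).
    ring.
  rewrite su sw; ring.
have P : farey_path n u w.
  (* As functions of [j] both determinants are solutions with the values 0 at [i] and 1 at
     [i + 1]. *)
  split=> // i j; apply: (@solution_ext a _ _ i (solution_shift aP (sD (i + n%:Z))) (sD i)).
    by rewrite /farey_det; ring.
  by rewrite W addrAC W.
exists (farey_arc u w), (farey_bridge w); split; first exact: farey_lifted.
(* A positive solution determines the coefficients of its recurrence, and [w] solves the one for the
   degrees as well. *)
move=> j; apply: (mulIf (lt0r_neq0 (w_gt0 j))).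
by rewrite -sw -(puncture_length_solution n_gt0 (farey_lifted n_gt0 P) (farey_puncture_length P)).
Qed.

(** * From the universal cover to the punctured disc *)

Section MarkedPoints.
Variable N' : nat.
Local Notation N := N'.+1.

Definition marked_point (x : int) : 'I_N := inord `|(x %% N%:Z)%Z|%N.

Lemma marked_pointE (x : int) : (marked_point x)%:Z = (x %% N%:Z)%Z.
Proof.
have := ltz_pmod x (isT : 0 < N%:Z); have := modz_ge0 x (isT : N%:Z != 0).
by rewrite /marked_point inordK; lia.
Qed.

Lemma marked_point_ord (i : 'I_N) : marked_point i%:Z = i.
Proof. by apply: val_inj; apply/eqP; rewrite -eqz_nat marked_pointE modz_small /= ?ltz_nat. Qed.

Lemma marked_pointD (x t : int) : marked_point (x + t * N%:Z) = marked_point x.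
Proof. by rewrite /marked_point addrC modzMDl. Qed.

Lemma lift_marked_point (x : int) :
  x = (marked_point x)%:Z + (x %/ N%:Z)%Z * N%:Z.
Proof. by rewrite marked_pointE addrC -divz_eq. Qed.

(** The guard restores the orientation that the absolute value of [y - x] forgets. *)
Definition lift_arc (T : seq (curve N)) (x y : int) : bool :=
  (x + 1 < y) && (Peripheral (marked_point x) `|y - x|%N \in T).
Definition lift_bridge (T : seq (curve N)) (x : int) : bool :=
  Bridging (marked_point x) \in T.

Lemma crosses_peripheral (x y x' y' : int) : x < y -> x' < y' ->
  (x < x' /\ x' < y /\ y < y') \/ (x' < x /\ x < y' /\ y' < y) ->
  crosses (Peripheral (marked_point x) `|y - x|%N)
          (Peripheral (marked_point x') `|y' - x'|%N).
Proof.
move=> xy x'y' cr; exists ((x' %/ N%:Z)%Z - (x %/ N%:Z)%Z) => /=.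
have := lift_marked_point x; have := lift_marked_point x'.
rewrite mulrBl; move: (_ * _) (_ * _) => q' q ex' ex; lia.
Qed.

Lemma crosses_bridging (b x y : int) : x < b -> b < y ->
  crosses (Bridging (marked_point b)) (Peripheral (marked_point x) `|y - x|%N).
Proof.
move=> xb yb; exists ((b %/ N%:Z)%Z - (x %/ N%:Z)%Z) => /=.
have := lift_marked_point x; have := lift_marked_point b.
rewrite mulrBl; move: (_ * _) (_ * _) => q' q ex' ex; lia.
Qed.

Lemma crosses_sym (c d : curve N) : crosses c d -> crosses d c.
Proof.
case: c d => [k|i l] [k'|i' l'] //= [t] /= H; exists (- t); rewrite mulNr; lia.
Qed.

Lemma lift_arc_translate (T : seq (curve N)) (i : 'I_N) (l : nat) (t : int) :
  (1 < l)%N -> Peripheral i l \in T ->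
  lift_arc T (i%:Z + t * N%:Z) (i%:Z + t * N%:Z + l%:Z).
Proof.
move=> l_gt1 Til; rewrite /lift_arc marked_pointD marked_point_ord.
rewrite [X in X - _]addrC addrK absz_nat Til andbT; lia.
Qed.

Lemma triangulation_lifted (T : seq (curve N)) :
  triangulation T -> lifted_triangulation N (lift_arc T) (lift_bridge T).
Proof.
case=> _ Tarc Tcross Tmax.
have AA x y x' y' : lift_arc T x y -> lift_arc T x' y' -> x < x' -> x' < y -> y < y' -> False.
  move=> /andP[xy Txy] /andP[x'y' Tx'y'] *.
  by apply: (Tcross _ _ Txy Tx'y'); apply: crosses_peripheral; lia.
have AP x y : lift_arc T (x + N%:Z) (y + N%:Z) = lift_arc T x y.
  rewrite /lift_arc -[in marked_point _](mul1r N%:Z) marked_pointD.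
  by rewrite addrAC ltrD2r opprD addrACA subrr addr0.
have ess i l : Peripheral i l \in T -> (1 < l)%N by case/Tarc.
split=> //.
- by move=> x; rewrite /lift_bridge -(mul1r N%:Z) marked_pointD.
- move=> x y Axy; case/andP: (Axy) => -> _ /=; rewrite leNgt; apply/negP => lt.
  have Axy' : lift_arc T (x + N%:Z) (y + N%:Z) by rewrite AP.
  by apply: (AA _ _ _ _ Axy Axy'); lia.
- move=> x y b /andP[xy Txy] Tb xb yb.
  by apply: (Tcross _ _ Tb Txy); apply: crosses_bridging.
- move=> b BB; apply: Tmax; first by split.
  case=> [k|i l] Td //= [t cr]; set q := (b %/ N%:Z)%Z.
  have bE := lift_marked_point b; rewrite -/q in bE.
  have lgt := ess _ _ Td.
  apply: (BB (i%:Z + (q - t) * N%:Z) (i%:Z + (q - t) * N%:Z + l%:Z)).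
  + exact: lift_arc_translate.
  + rewrite mulrBl; lia.
  rewrite mulrBl; lia.
move=> x y xy yN AA1 AA2 BB; rewrite /lift_arc xy /=.
set q := (x %/ N%:Z)%Z; have xE := lift_marked_point x; rewrite -/q in xE.
apply: Tmax.
  split; first by rewrite /=; lia.
  (* A nonzero translation moves the curve by at least [N], hence by at least its own length. *)
  case=> t /= H; have t0 : t != 0 by apply/eqP => t0; rewrite t0 in H; lia.
  have : N%:Z <= `|t * N%:Z| by rewrite normrM ler_peMl //; lia.
  move: (t * _) H => w; lia.
case=> [k|i l] Td /= [t cr].
  apply: (BB (k%:Z + (t + q) * N%:Z)).
  + by rewrite /lift_bridge marked_pointD marked_point_ord.
  + rewrite mulrDl; lia.
  rewrite mulrDl; lia.
have lgt := ess _ _ Td.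
have Ad := lift_arc_translate (t + q) lgt Td.
rewrite mulrDl in Ad; case: cr => [cr|cr]; [apply: (AA1 _ _ Ad)|apply: (AA2 _ _ Ad)]; lia.
Qed.

Definition lifted_curve (A : int -> int -> bool) (B : int -> bool) (c : curve N) : bool :=
  match c with Bridging i => B i%:Z | Peripheral i l => A i%:Z (i%:Z + l%:Z) end.

Definition projected_arcs (A : int -> int -> bool) (B : int -> bool) : seq (curve N) :=
  [seq c <- [seq Bridging i | i <- enum 'I_N] ++
            [seq Peripheral i l | i <- enum 'I_N, l <- iota 0 N.+1] | lifted_curve A B c].

Lemma projected_arcs_uniq (A : int -> int -> bool) (B : int -> bool) :
  uniq (projected_arcs A B).
Proof.
apply: filter_uniq; rewrite cat_uniq map_inj_uniq ?enum_uniq; last by move=> i j [].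
rewrite allpairs_uniq ?enum_uniq ?iota_uniq ?andbT //; last by move=> [i l] [j k] _ _ [-> ->].
by apply/hasPn => _ /allpairsP[[i l] [_ _ ->]]; apply/mapP => -[].
Qed.

Section Project.
Variables (A : int -> int -> bool) (B : int -> bool).
Hypothesis T : lifted_triangulation N A B.

Lemma mem_projected_arcs (c : curve N) :
  (c \in projected_arcs A B) = lifted_curve A B c.
Proof.
rewrite mem_filter; case: (boolP (lifted_curve A B c)) => // Lc.
rewrite andTb mem_cat; case: c Lc => [i|i l] Lc; apply/orP; [left|right].
  by apply: map_f; rewrite mem_enum.
apply/allpairsP; exists (i, l); rewrite mem_enum mem_iota; split=> //=.
have := @arc_length _ _ _ T i%:Z (i%:Z + l%:Z) Lc; lia.
Qed.

Lemma arc_periodicZ (x y t : int) : A (x + t * N%:Z) (y + t * N%:Z) = A x y.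
Proof.
have := @periodicZ _ (fun z => A (x + z) (y + z)) N%:Z 0 t.
rewrite /= !add0r !addr0; apply=> z.
by rewrite !addrA (arc_periodic T).
Qed.

Lemma bridge_periodicZ (x t : int) : B (x + t * N%:Z) = B x.
Proof. exact: (periodicZ _ _ (bridge_periodic T)). Qed.

Lemma lifted_marked_arc (x y : int) :
  A (marked_point x)%:Z ((marked_point x)%:Z + (y - x)) = A x y.
Proof.
rewrite -(arc_periodicZ _ _ (x %/ N%:Z)%Z) addrAC -lift_marked_point.
by rewrite addrC subrK.
Qed.

Lemma lifted_marked_bridge (x : int) : B (marked_point x)%:Z = B x.
Proof. by rewrite -(bridge_periodicZ _ (x %/ N%:Z)%Z) -lift_marked_point. Qed.

Lemma projected_noncrossing (c d : curve N) :
  lifted_curve A B c -> lifted_curve A B d -> ~ crosses c d.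
Proof.
have BA k i l : lifted_curve A B (Bridging k) -> lifted_curve A B (Peripheral i l) ->
    ~ crosses (Bridging k) (Peripheral i l).
  move=> /= Bk Ail [t /andP[? ?]]; rewrite -(bridge_periodicZ _ t) in Bk.
  exact: (bridge_noncrossing T Ail Bk).
case: c d => [k|i l] [k'|i' l'] Lc Ld; [by [] | exact: BA | |].
  by move/crosses_sym; exact: (BA _ _ _ Ld Lc).
move=> /= [t]; move: Lc Ld => /=; rewrite -(arc_periodicZ i'%:Z _ t) addrAC => Ac Ad.
case=> -[? [? ?]]; first exact: (arc_noncrossing T Ac Ad).
exact: (arc_noncrossing T Ad Ac).
Qed.

Lemma lifted_arc_mem (x y : int) : A x y ->
  Peripheral (marked_point x) `|y - x|%N \in projected_arcs A B.
Proof.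
move=> Axy; have := arc_length T Axy => xy; rewrite mem_projected_arcs /=.
by rewrite gez0_abs ?lifted_marked_arc //; lia.
Qed.

Lemma lifted_bridge_mem (x : int) : B x ->
  Bridging (marked_point x) \in projected_arcs A B.
Proof. by rewrite mem_projected_arcs /= lifted_marked_bridge. Qed.

Lemma projected_triangulation : triangulation (projected_arcs A B).
Proof.
split; first exact: projected_arcs_uniq.
- move=> c; rewrite mem_projected_arcs => Lc; split; last exact: projected_noncrossing.
  by case: c Lc => //= i l /(arc_length T); lia.
- move=> c d; rewrite !mem_projected_arcs; exact: projected_noncrossing.
case=> [k|i l] [ess ncr] nT; rewrite mem_projected_arcs /=.
  apply: (bridge_maximal T) => x y Axy xk yk.
  apply: (nT _ (lifted_arc_mem Axy)).
  by rewrite -(marked_point_ord k); apply: crosses_bridging.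
have ilE : Peripheral i l = Peripheral (marked_point i%:Z) (absz (i%:Z + l%:Z - i%:Z)%R).
  by rewrite marked_point_ord addrAC subrr add0r absz_nat.
have l_gt1 : (1 < l)%N by [].
apply: (arc_maximal T); first by lia.
(* A curve longer than [N] crosses its translate by one turn. *)
- rewrite leNgt; apply/negP => lt; apply: ncr; exists 1; lia.
- move=> x' y' A' *; apply: (nT _ (lifted_arc_mem A')); rewrite ilE.
  by have len := arc_length T A'; apply: crosses_peripheral; lia.
- move=> x' y' A' *; apply: (nT _ (lifted_arc_mem A')); rewrite ilE.
  by have len := arc_length T A'; apply: crosses_peripheral; lia.
move=> b Bb *; apply: (nT _ (lifted_bridge_mem Bb)); rewrite ilE.
by apply: crosses_sym; apply: crosses_bridging.
Qed.

End Project.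
End MarkedPoints.

(** * Counting arc ends *)

Section Count.
Variable N' : nat.
Local Notation N := N'.+1.

(** Turns a condition on the terminal point into one on the initial point [i], so that sums over [i]
    collapse to one term. *)
Lemma peripheral_end (i : 'I_N) (l : nat) (x : int) :
  ((i + l) %% N == marked_point N' x)%N = (i == marked_point N' (x - l%:Z)).
Proof.
have endE : ((i + l) %% N)%N = marked_point N' (i%:Z + l%:Z).
  by apply/eqP; rewrite -eqz_nat marked_pointE -PoszD modz_nat.
rewrite endE -[in RHS](marked_point_ord i) -[RHS](inj_eq val_inj) /=.
rewrite -2!eqz_nat !marked_pointE.
rewrite -[in RHS](eqz_modDr l%:Z).
by rewrite subrK.
Qed.

(** Initial ends at [x] give the right degree; terminal ends, with a single possible initial point
    for each length, give the left degree. *)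
Lemma projected_arc_ends (A : int -> int -> bool) (B : int -> bool) (x : int) :
  lifted_triangulation N A B ->
  (1 + \sum_(c <- projected_arcs N' A B) arc_ends c (marked_point N' x))%N
  = degree N A B x.
Proof.
move=> T; rewrite /degree -!addnA; congr (1 + _)%N.
rewrite big_filter big_mkcond big_cat big_map big_allpairs_dep.
rewrite -[iota 0 N.+1]/(index_iota 0 N.+1) /=; congr (_ + _)%N.
  rewrite big_enum /= (bigD1 (marked_point N' x)) //= eqxx (lifted_marked_bridge T).
  rewrite big1 ?addn0; first by case: (B x).
  by move=> i /negbTE ne; rewrite ne; case: (B _).
rewrite big_enum /=.
under eq_bigr => i _.
  rewrite (eq_bigr (fun l => (A i%:Z (i%:Z + l%:Z)%R * (i == marked_point N' x))
     + A i%:Z (i%:Z + l%:Z)%R * (i == marked_point N' (x - l%:Z)%R))%N); last first.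
    by move=> l _; rewrite peripheral_end -mulnDr; case: (A _ _); rewrite ?mul1n.
  rewrite big_split /=.
  over.
rewrite big_split /=; congr (_ + _)%N.
  rewrite (bigD1 (marked_point N' x)) //= eqxx [X in (_ + X)%N]big1 ?addn0.
    apply: eq_bigr => l _; rewrite muln1 -(lifted_marked_arc T x) [in RHS]addrAC.
    by rewrite subrr add0r.
  by move=> i /negbTE ->; apply: big1 => l _; rewrite muln0.
rewrite exchange_big /=; apply: eq_bigr => l _.
rewrite (bigD1 (marked_point N' (x - l%:Z))) //= eqxx big1 ?addn0.
  rewrite muln1 -(lifted_marked_arc T (x - l%:Z)); congr (nat_of_bool (A _ (_ + _))).
  by rewrite opprB addrC subrK.
by move=> i /negbTE ->; rewrite muln0.
Qed.

Lemma triangulation_perm (T : seq (curve N)) : triangulation T ->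
  perm_eq T (projected_arcs N' (lift_arc T) (lift_bridge T)).
Proof.
move=> triT; have [uT arcT _ _] := triT.
apply: uniq_perm => //; first exact: projected_arcs_uniq.
move=> c; rewrite (mem_projected_arcs (triangulation_lifted triT)).
case: c => [i|i l] /=; first by rewrite /lift_bridge marked_point_ord.
rewrite /lift_arc marked_point_ord [X in X - _]addrC addrK absz_nat.
case Til: (Peripheral i l \in T); last by rewrite andbF.
have [/= l_gt1 _] := arcT _ Til; rewrite andbT; lia.
Qed.

Lemma size_triangulation_sequence (T : seq (curve N)) :
  size (triangulation_sequence T) = N.
Proof. by rewrite size_map size_enum_ord. Qed.

Lemma nth_triangulation_sequence (T : seq (curve N)) (x : int) :
  nth 0%N (triangulation_sequence T) `|(x %% N%:Z)%Z|%N
  = (1 + \sum_(c <- T) arc_ends c (marked_point N' x))%N.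
Proof.
have -> : `|(x %% N%:Z)%Z|%N = marked_point N' x.
  by apply/eqP; rewrite -eqz_nat marked_pointE gez0_abs ?modz_ge0.
by rewrite (nth_map ord0) ?size_enum_ord // nth_ord_enum.
Qed.

End Count.

Theorem proposition4p4 (m : int -> int -> int) (n : nat)
    (frieze_m : infinite_frieze m) (period_n : minimal_period m n) :
  ((exists k : nat, (0 < k)%N /\ growth_coefficient m n k = 2) <->
   (forall k : nat, growth_coefficient m n k = 2)) /\
  ((forall k : nat, growth_coefficient m n k = 2) <->
   arises_from_punctured_disc m).
Proof.
have [[n_gt0 perm] _] := period_n; pose a j := m j j.
have aP j : a (j + n%:Z) = a j by apply: perm; lia.
have [X [Z [[sX sZ] [X0 X1 Z0 Z1] X_gt0 sE]]] := frieze_growth n frieze_m.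
have ab : (exists k : nat, (0 < k)%N /\ growth_coefficient m n k = 2) ->
    forall k, growth_coefficient m n k = 2.
  case=> k [k_gt0]; rewrite sE // => sk i; rewrite sE //.
  apply: (growth_eq2_all sX sZ X0 X1 Z0 Z1 n_gt0 aP).
  exact: (growth_eq2_one sX sZ X0 X1 Z0 Z1 X_gt0 n_gt0 aP k_gt0 sk).
split; split=> //; first by move=> s2; exists 1%N.
  move=> s2; have := s2 1%N; rewrite sE // => s1.
  have [v [sv vP v_gt0]] :=
    growth_eq2_periodic_solution sX sZ X0 X1 Z0 Z1 X_gt0 n_gt0 aP s1.
  have [A [B [T deg]]] := periodic_solution_triangulation n_gt0 sv aP vP v_gt0.
  case: n n_gt0 T deg {perm period_n aP ab sE s1 s2 vP} => // n' _ T deg.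
  exists n'.+1, (projected_arcs n' A B); split=> //; first exact: projected_triangulation.
  split; first by rewrite size_triangulation_sequence.
  exists 0 => j; rewrite add0r size_triangulation_sequence nth_triangulation_sequence.
  by rewrite (projected_arc_ends _ T) deg.
case=> -[|N'] [T [// _ triT]]; rewrite /quiddity_sequence size_triangulation_sequence.
(* The length [N'.+1] of the quiddity sequence need not be a multiple of [n]; over the common period
   [N'.+1 * n] the trace is the growth coefficient of index [N'.+1]. *)
case=> _ [i0 quid]; apply: ab; exists N'.+1; split=> //; rewrite sE //.
have TL := triangulation_lifted triT.
have [v [pv vP v_gt0]] := puncture_length_exists (isT : (0 < N'.+1)%N) TL.
have sv := puncture_length_solution (isT : (0 < N'.+1)%N) TL pv.
pose y j := v (j - i0).
have sy : solution a y.
  move=> j; rewrite /y; have := sv (j - i0).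
  rewrite -[in X in _ = X * _ -> _](projected_arc_ends _ TL).
  rewrite -(perm_big _ (triangulation_perm triT)) -nth_triangulation_sequence -quid.
  rewrite [i0 + _]addrC subrK => <-; congr (v _ + v _); lia.
have yP j : y (j + (N'.+1 * n)%N%:Z) = y j.
  rewrite /y addrAC [(_ * n)%N]mulnC PoszM; exact: periodicZ.
have aPN j : a (j + (N'.+1 * n)%N%:Z) = a j.
  by rewrite PoszM; apply: (periodicZ _ _ aP).
have Nn_gt0 : (0 < N'.+1 * n)%N by rewrite muln_gt0.
have := periodic_solution_growth sX sZ X0 X1 Z0 Z1 aPN sy yP (lt0r_neq0 (v_gt0 (i0 - i0))).
by rewrite mul1n.
Qed.
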